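(* Let $N\ge 1$ be an integer and let $\tau\ge 0$ be an even integer with $N>2\tau$. Let ${\bf F}\in\mathbb{R}^N$ be a vector such that ${\bf f}=\mathcal{DFT}\{{\bf F}\}$ satisfies $f(k)=0$ for all $k\in\{0,\ldots,N-1\}\setminus CS$. Then the sign problem with data $|{\bf F}|^2$ has a unique solution up to a global $\pm1$ sign ambiguity; that is, if ${\bf G}\in\mathbb{R}^N$ satisfies $|G_j|^2=|F_j|^2$ for all $j=0,\ldots,N-1$ and ${\bf g}=\mathcal{DFT}\{{\bf G}\}$ satisfies $g(k)=0$ for all $k\in\{0,\ldots,N-1\}\setminus CS$, then ${\bf G}={\bf F}$ or ${\bf G}=-{\bf F}$.
   Context: Vectors are indexed as ${\bf F}=(F_0,\ldots,F_{N-1})$. With $\omega_j=2\pi j/N$ and $\mathrm{i}=\sqrt{-1}$, the discrete Fourier transform is $$\mathcal{DFT}\{{\bf F}\}(k)=\frac1N\sum_{j=0}^{N-1}F_j e^{\mathrm{i}\omega_j k},\qquad k=0,\ldots,N-1.$$ The compact support set (of length $\tau+1$) for the sign problem is $$CS=\{k\in\{0,\ldots,N-1\}: k\equiv \ell \ (\mathrm{mod}\ N)\ \text{for some integer } \ell \text{ with } -\tau/2\le \ell\le \tau/2\},$$ and a vector ${\bf f}\in\mathbb{C}^N$ is said to have this compact support if $f(k)=0$ for all $k\notin CS$ (with $\tau$ known). The sign problem is: given the entrywise squared magnitudes $|{\bf F}|^2=(|F_j|^2)_j$ of a real vector ${\bf F}$ whose $\mathcal{DFT}$ vanishes outside $CS$,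 recover ${\bf F}$ (equivalently, its signs). Solutions are real vectors with the given magnitudes whose $\mathcal{DFT}$ vanishes outside the same set $CS$. *)

(* Defs.v *)
(* MathComp-Analysis; complex numbers are R[i] from mathcomp-real-closed. *)
From HB Require Import structures.
From mathcomp Require Export all_boot all_order all_algebra.
From mathcomp Require Export complex.
From mathcomp Require Export boolp classical_sets reals sequences exp trigo.

Set Implicit Arguments.
Unset Strict Implicit.
Unset Printing Implicit Defensive.

Import Order.TTheory GRing.Theory Num.Theory.

Local Open Scope ring_scope.
Local Open Scope complex_scope.
Local Open Scope classical_set_scope.

(* exp (a + i b) = e^a (cos b + i sin b); the complex exponential is missing
   from the libraries. *)
Definition cexp (R : realType) (z : R[i]) : R[i] :=
  let: a +i* b := z in (expR a)%:C * (cos b +i* sin b).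

Definition omega (R : realType) (N j : nat) : R := 2 * pi * j%:R / N%:R.

(* The factor 1/N and the sign + in the exponent are part of this convention:
   f(k) = (1/N) \sum_j F_j e^(i omega_j k). *)
Definition DFT (R : realType) (N : nat) (F : 'rV[R[i]]_N) : 'rV[R[i]]_N :=
  \row_(k < N) (N%:R^-1 *
    \sum_(j < N) F 0 j * cexp ('i%C * (omega R N j)%:C * k%:R)).

(* The bounds -tau/2 <= l <= tau/2 are read in rat, so that tau/2 is the exact
   half of tau. *)
Definition CS (N tau : nat) : set 'I_N :=
  [set k : 'I_N | exists l : int,
     - (tau%:Q / 2) <= l%:Q <= tau%:Q / 2
     /\ (k%:Z = l %[mod N%:Z])%Z].

Definition compactly_supported (R : realType) (N tau : nat)
    (f : 'rV[R[i]]_N) : Prop :=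
  forall k : 'I_N, ~ CS tau k -> f 0 k = 0.

Definition sqmag (R : realType) (N : nat) (F : 'rV[R]_N) : 'rV[R]_N :=
  \row_(j < N) `|F 0 j| ^+ 2.

Definition sign_solution (R : realType) (N tau : nat) (D G : 'rV[R]_N) : Prop :=
  sqmag G = D /\
  compactly_supported tau (DFT (map_mx (real_complex R) G)).

(* Main.v *)
Require Import Defs.
From mathcomp Require Import zify ring lra.

Import Order.TTheory GRing.Theory Num.Theory.
Local Open Scope ring_scope.

Set Implicit Arguments.
Unset Strict Implicit.
Unset Printing Implicit Defensive.

(** A vector whose DFT lives on the frequencies [-tau/2 .. tau/2] is, after
    multiplication by a nowhere vanishing factor, a polynomial of degree at most
    [tau] sampled at the [N]-th roots of unity
    ([compactly_supported_polynomial], which rests on Fourier inversion).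
    If [F] and [G] have equal magnitudes then [(F_j - G_j)(F_j + G_j) = 0] for
    every [j]. Both factors are again supported in [CS] because the DFT is
    additive, so the product of their two polynomials has degree at most
    [2 * tau < N] and yet vanishes at [N] distinct points. It is therefore the
    zero polynomial, and since polynomials over a field form an integral domain,
    one of the two factors is zero: [G = F] or [G = - F]. *)

Definition cis (R : realType) (t : R) : R[i] := (cos t +i* sin t)%C.

Lemma cisX (R : realType) (t : R) n : cis t ^+ n = cis (t * n%:R).
Proof.
elim: n => [|n IHn]; first by rewrite mulr0 /cis cos0 sin0 expr0.
rewrite exprS IHn -natr1 mulrDr mulr1 /cis cosD sinD.
by apply/eqP; rewrite eq_complex /=; apply/andP; split; apply/eqP; ring.
Qed.

(** By the half-angle formula [cos t = 1 - 2 sin(t/2)^2], and [sin] is positive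
    on the open interval from [0] to [pi]. *)
Lemma cis_neq1 (R : realType) (t : R) : 0 < t < 2 * pi -> cis t != 1.
Proof.
move=> /andP[t0 t2]; apply/eqP => -[cos1 _].
have sin_half : 0 < sin (t / 2) by apply: sin_gt0_pi; lra.
have := cos_mulr2n (t / 2); rewrite cos2sin2 (_ : t / 2 *+ 2 = t); last by lra.
by rewrite cos1; nra.
Qed.

Definition zeta (R : realType) (N : nat) : R[i] := cis (omega R N 1).

Lemma zeta_primitive (R : realType) (N : nat) :
  (0 < N)%N -> N.-primitive_root (zeta R N).
Proof.
move=> N0; have NR0 : (0 : R) < N%:R by rewrite ltr0n.
rewrite /primitive_root_of_unity N0; apply/forallP => i.
rewrite unity_rootE cisX /omega mulr1; apply/eqP.
case: (eqVneq i.+1 N) => [->|neN].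
  by rewrite divfK ?lt0r_neq0// mulr_natl /cis cos2pi sin2pi !eqxx.
have ltiN : (i.+1 < N)%N by rewrite ltn_neqAle neN ltn_ord.
apply/negbTE/cis_neq1; have pi0 := pi_gt0 R.
rewrite !mulr_gt0 ?invr_gt0 ?ltr0n//=.
by rewrite -mulrA gtr_pMr ?mulr_gt0// mulrC ltr_pdivrMr// mul1r ltr_nat.
Qed.

Lemma cexp_zeta (R : realType) (N j k : nat) :
  cexp ('i%C * (omega R N j)%:C%C * k%:R) = zeta R N ^+ (j * k).
Proof.
rewrite cisX -(rmorph_nat (real_complex R)) /= /cexp; simpc.
rewrite /= expR0 !mul1r (_ : omega R N j * k%:R = omega R N 1 * (j * k)%:R) //.
by rewrite /omega natrM; ring.
Qed.

(** The sum is geometric, with ratio [u = z ^+ i / z ^+ j] satisfying [u ^+ N = 1]: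
    when [i != j] the ratio is not [1], so the sum vanishes. *)
Lemma prim_root_orthogonality (K : fieldType) (N : nat) (z : K) (i j : 'I_N) :
    N.-primitive_root z ->
  \sum_(k < N) z ^+ (i * k) * z^-1 ^+ (j * k) = (N * (i == j))%N%:R.
Proof.
move=> prim; have z0 := prim_root_eq0 prim.
have zn0 : z != 0 by rewrite z0 -lt0n (leq_ltn_trans _ (ltn_ord i)).
under eq_bigr do rewrite !exprM -exprMn.
have [<-|neij] := eqVneq i j.
  rewrite exprVn divff ?expf_neq0// muln1.
  by under eq_bigr do rewrite expr1n; rewrite sumr_const card_ord.
rewrite muln0; set u := (z ^+ i * _).
have u1 : u - 1 != 0.
  rewrite subr_eq0 /u exprVn; apply: contra neij => /eqP/divr1_eq/eqP.
  by rewrite (eq_prim_root_expr prim) !modn_small.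
apply: (mulfI u1); rewrite -subrX1 mulr0 /u exprMn exprVn -exprVn.
by rewrite -!exprM ![(_ * N)%N]mulnC !exprM exprVn (prim_expr_order prim) invr1
  !expr1n mulr1 subrr.
Qed.

Lemma DFT_inversion (R : realType) (N : nat) (H : 'rV[R[i]]_N) (j : 'I_N) :
  H 0 j = \sum_(k < N) DFT H 0 k * (zeta R N)^-1 ^+ (j * k).
Proof.
have N0 : (0 < N)%N by apply: leq_ltn_trans (ltn_ord j).
under eq_bigr => k _.
  rewrite mxE -mulrA mulr_suml.
  under eq_bigr do rewrite cexp_zeta -mulrA.
  over.
rewrite -mulr_sumr exchange_big /=.
under eq_bigr do
  rewrite -mulr_sumr (prim_root_orthogonality _ _ (zeta_primitive R N0)).
rewrite (bigD1 j)//= eqxx muln1 big1 => [|i /negbTE->]; last first.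
  by rewrite muln0 mulr0.
by rewrite addr0 mulrCA mulVf ?mulr1// pnatr_eq0 -lt0n.
Qed.

Lemma DFTD (R : realType) (N : nat) (H K : 'rV[R[i]]_N) :
  DFT (H + K) = DFT H + DFT K.
Proof.
apply/rowP => k; rewrite !mxE -mulrDr -big_split /=; congr (_ * _).
by apply: eq_bigr => j _; rewrite mxE mulrDl.
Qed.

Lemma DFTN (R : realType) (N : nat) (H : 'rV[R[i]]_N) : DFT (- H) = - DFT H.
Proof.
apply/rowP => k; rewrite !mxE -mulrN -sumrN; congr (_ * _).
by apply: eq_bigr => j _; rewrite mxE mulNr.
Qed.

(** Shifting the frequencies by half the bandwidth moves the symmetric window
    into the residues [0 .. tau]; no wrap-around occurs as [tau < N]. *)
Lemma CS_shift (N tau : nat) (k : 'I_N) :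
  (tau < N)%N -> CS tau k -> ((k + tau./2) %% N <= tau)%N.
Proof.
move=> ltN [l [/andP[]]].
rewrite lerNl !ler_pdivlMr// => lo hi mod_l.
have {}lo : - l * 2 <= tau%:Z by rewrite -(ler_int rat) rmorphM rmorphN.
have {}hi : l * 2 <= tau%:Z by rewrite -(ler_int rat) rmorphM.
have : ((k + tau./2)%N%:Z = l + tau./2%:Z %[mod N%:Z])%Z.
  by rewrite PoszD -modzDml mod_l modzDml.
rewrite [RHS]modz_small; lia.
Qed.

(** In the inversion formula, the shift by [tau./2] turns the negative exponents
    of the inverse root of unity into residues at most [tau], which can then
    serve as polynomial exponents. *)
Lemma compactly_supported_polynomial (R : realType) (N tau : nat)
    (H : 'rV[R[i]]_N) :
    (tau < N)%N -> compactly_supported tau (DFT H) ->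
  exists2 p : {poly R[i]}, (size p <= tau.+1)%N &
    forall j : 'I_N,
      p.[(zeta R N)^-1 ^+ j] = H 0 j * (zeta R N)^-1 ^+ (j * tau./2).
Proof.
move=> ltN suppH; set w := _^-1.
have N0 : (0 < N)%N by apply: leq_ltn_trans ltN.
have wN : w ^+ N = 1.
  by rewrite exprVn (prim_expr_order (zeta_primitive R N0)) invr1.
exists (\sum_(k < N) DFT H 0 k *: 'X^((k + tau./2) %% N)).
  apply/(leq_trans (size_sum _ _ _))/bigmax_leqP => k _.
  have [inCS|/suppH->] := pselect (CS tau k); last by rewrite scale0r size_poly0.
  by rewrite (leq_trans (size_scale_leq _ _))// size_polyXn ltnS CS_shift.
move=> j; rewrite horner_sum DFT_inversion mulr_suml; apply: eq_bigr => k _.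
rewrite hornerZ hornerXn -mulrA -exprD -mulnDr exprM; congr (_ * _).
by rewrite expr_mod// exprAC wN expr1n.
Qed.

(** Entrywise products of supported vectors behave as in an integral domain: the
    product of the two interpolating polynomials has degree at most [2 * tau],
    too small for its [N] distinct roots, so it vanishes identically. *)
Lemma compactly_supported_mul_eq0 (R : realType) (N tau : nat)
    (H K : 'rV[R[i]]_N) :
    (2 * tau < N)%N ->
    compactly_supported tau (DFT H) -> compactly_supported tau (DFT K) ->
    (forall j, H 0 j * K 0 j = 0) ->
  H = 0 \/ K = 0.
Proof.
move=> ltN suppH suppK HK0; have ltN' : (tau < N)%N by lia.
have N0 : (0 < N)%N by lia.
have [p szp Hp] := compactly_supported_polynomial ltN' suppH.
have [q szq Kq] := compactly_supported_polynomial ltN' suppK.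
have prim := zeta_primitive R N0; set w := (zeta R N)^-1 in Hp Kq.
have w0 : w != 0 by rewrite invr_eq0 (prim_root_eq0 prim) -lt0n.
have eq0 (L : 'rV[R[i]]_N) r :
    (forall j : 'I_N, r.[w ^+ j] = L 0 j * w ^+ (j * tau./2)) -> r = 0 -> L = 0.
  move=> Lr r0; apply/rowP => j; rewrite mxE; apply/eqP.
  by have /esym/eqP := Lr j; rewrite r0 horner0 mulf_eq0 expf_eq0 (negbTE w0)
    andbF orbF.
suff /eqP : p * q = 0.
  by rewrite mulf_eq0 => /orP[] /eqP; [left; apply: eq0 Hp _|right; apply: eq0 Kq _].
apply/eqP/negP => /negP pq0.
have := max_poly_roots pq0 (rs := [seq w ^+ (j : 'I_N) | j <- enum 'I_N]).
rewrite size_map size_enum_ord => /(_ _ _)/wrap[].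
- apply/allP => _ /mapP[j _ ->].
  by rewrite rootE hornerM Hp Kq mulrACA HK0 mul0r.
- rewrite map_inj_uniq ?enum_uniq// => i j; rewrite !exprVn => /invr_inj/eqP.
  by rewrite (eq_prim_root_expr prim) !modn_small// => /eqP/val_inj.
- apply/negP; rewrite -leqNgt (leq_trans (size_polyMleq p q))//.
  apply: (@leq_trans (tau.+1 + tau.+1).-1); last by lia.
  by rewrite -!subn1 leq_sub2r// leq_add.
Qed.

Theorem theorem1 (R : realType) (N tau : nat) (hN : (1 <= N)%N)
    (htau : ~~ odd tau) (hNtau : (2 * tau < N)%N) (F : 'rV[R]_N)
    (hF : compactly_supported tau (DFT (map_mx (real_complex R) F))) :
  forall G : 'rV[R]_N, sign_solution tau (sqmag F) G -> G = F \/ G = - F.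
Proof.
move=> G [magG hG].
have cst_eq0 (L : 'rV[R]_N) : map_mx (real_complex R) L = 0 -> L = 0.
  by move/eqP; rewrite map_mx_eq0 => /eqP.
have [] := @compactly_supported_mul_eq0 R N tau
    (map_mx (real_complex R) (G - F)) (map_mx (real_complex R) (G + F)) hNtau.
- by rewrite map_mxB DFTD DFTN => k nk; rewrite mxE hG// mxE hF// subr0.
- by rewrite map_mxD DFTD => k nk; rewrite mxE hG// hF// addr0.
- move=> j; rewrite !mxE -rmorphM /=.
  move/rowP: magG => /(_ j); rewrite !mxE !real_normK ?num_real// => magG.
  by rewrite -subr_sqr magG subrr.
- by move/cst_eq0/eqP; rewrite subr_eq0 => /eqP; left.
- by move/cst_eq0/eqP; rewrite addr_eq0 => /eqP; right.
Qed.
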